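(* Let $\mathbb{K}$ be a field with $\operatorname{char}\mathbb{K}\neq 2$, and let $H$ be the $m\times n$ generic Hankel matrix over $\mathbb{K}$. Assume that one of the following holds: (1) $(m,n)=(2,3)$; (2) $(m,n)=(3,3)$. Then $\operatorname{v}(P_2(H))=3$.
   Context: The $m\times n$ generic Hankel matrix over $\mathbb{K}$ is $H=(h_{ij})$ with $h_{ij}=x_{i+j-1}$ for $1\le i\le m$, $1\le j\le n$, where $x_1,\dots,x_{m+n-1}$ are algebraically independent indeterminates; we work in the standard graded polynomial ring $R=\mathbb{K}[x_1,\dots,x_{m+n-1}]$. $P_2(H)\subseteq R$ denotes the $2\times 2$ permanental ideal of $H$: the ideal generated by all $2\times2$ subpermanents $h_{ik}h_{jl}+h_{il}h_{jk}$ with $1\le i<j\le m$, $1\le k<l\le n$. For a graded ideal $I$ of a standard graded polynomial ring $R=\bigoplus_{d\ge0}R_d$ over a field, the $\operatorname{v}$-number of $I$ is $$\operatorname{v}(I)=\min\{d\mid \text{there exist } f\in R_d \text{ and } \mathfrak{p}\in\operatorname{Ass}(I)\text{ such that } (I:f)=\mathfrak{p}\},$$ where $\operatorname{Ass}(I)$ is the set of associated primes of $R/I$ and $(I:f)=\{g\in R\mid gf\in I\}$. *)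

(* Defs.v *)
From mathcomp Require Import all_boot all_algebra.
From mathcomp Require Import mpoly.

Set Implicit Arguments.
Unset Strict Implicit.
Unset Printing Implicit Defensive.

Import GRing.Theory.
Local Open Scope ring_scope.

(* Ideals are Prop-valued predicates, compared extensionally by [ideal_eq]:
   the boolean predicates of ring_quotient would require membership in a
   finitely generated ideal to be decidable. *)
Section Ideals.
Variable R : comNzRingType.
Implicit Types (I J P S : R -> Prop) (f g : R).

Definition is_ideal I : Prop :=
  [/\ I 0, (forall f g, I f -> I g -> I (f + g))
    & (forall f g, I g -> I (f * g))].

Definition is_prime_ideal P : Prop :=
  [/\ is_ideal P, ~ P 1 & (forall f g, P (f * g) -> P f \/ P g)].

Definition ideal_gen S : R -> Prop :=
  fun f => forall J, is_ideal J -> (forall s, S s -> J s) -> J f.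

Definition colon I f : R -> Prop := fun g => I (g * f).

Definition ideal_eq I J : Prop := forall f, I f <-> J f.

(* Annihilators in R / I of single elements are the ideals (I : g). *)
Definition Ass I P : Prop :=
  is_prime_ideal P /\ exists g, ideal_eq P (colon I g).

End Ideals.

Definition v_degree (K : fieldType) (k : nat) (I : {mpoly K[k]} -> Prop)
    (d : nat) : Prop :=
  exists (f : {mpoly K[k]}) (P : {mpoly K[k]} -> Prop),
    [/\ f \is d.-homog, Ass I P & ideal_eq (colon I f) P].

(* The v-number as a relation: v(I) is the minimum of a set of degrees that
   may be empty for a general (e.g. the unit) ideal. *)
Definition is_v_number (K : fieldType) (k : nat) (I : {mpoly K[k]} -> Prop)
    (d : nat) : Prop :=
  v_degree I d /\ (forall e : nat, v_degree I e -> (d <= e)%N).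

Lemma hankel_idx_subproof (m n : nat) (i : 'I_m) (j : 'I_n) :
  (i + j < (m + n).-1)%N.
Proof.
case: m i => [[//]|m] i; rewrite addSn /=.
by rewrite -addnS leq_add // -ltnS.
Qed.

(* With rows, columns and variables all numbered from 0, the index i + j - 1
   becomes i + j. *)
Definition hankel_idx (m n : nat) (i : 'I_m) (j : 'I_n) : 'I_(m + n).-1 :=
  Ordinal (hankel_idx_subproof i j).

Definition hankel (K : fieldType) (m n : nat) :
    'M[{mpoly K[(m + n).-1]}]_(m, n) :=
  \matrix_(i < m, j < n) 'X_(hankel_idx i j).

Definition subperm2 (R : comNzRingType) (m n : nat) (A : 'M[R]_(m, n)) (f : R) :
    Prop :=
  exists (i j : 'I_m) (k l : 'I_n),
    [/\ (i < j)%N, (k < l)%N & f = A i k * A j l + A i l * A j k].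

Definition perm2_ideal (R : comNzRingType) (m n : nat) (A : 'M[R]_(m, n)) :
    R -> Prop :=
  ideal_gen (subperm2 A).

(* Main.v *)
Require Import Defs.
From mathcomp Require Import all_boot all_algebra.
From mathcomp Require Import mpoly ring.

Set Implicit Arguments.
Unset Strict Implicit.
Unset Printing Implicit Defensive.

Import GRing.Theory.
Local Open Scope ring_scope.

(** Write a, b, c, ... for the entries of the Hankel matrix.  Since 2 is
    invertible, abd and acd lie in the ideal I, so every prime P containing I
    contains b, c (and d in the 3 x 3 case) together with one of the two
    extreme variables.  If (I : f) = P with deg f <= 2, then P annihilates f;
    reducing f modulo I to a combination of a few monomials, the products of f
    with the elements of P are seen to be nonzero modulo I unless f lies in I.
    What detects them is that I maps into (s^4) under the two evaluations
    (a, b, c, d) = (1, s, -s^2, s^3) and its mirror image, and, for the 3 x 3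
    matrix, a linear form on cubics that vanishes on I but not on c^3.
    Degree 3 is attained by a d^2 with (I : a d^2) = (a, b, c) for the 2 x 3
    matrix, and by c^3, whose colon ideal is the maximal homogeneous ideal,
    for the 3 x 3 matrix. *)

(** * Ideals, colon ideals and divisibility after a ring morphism *)

Section IdealTheory.
Variable R : comNzRingType.
Implicit Types (I J P S : R -> Prop) (f g : R).

Lemma is_ideal_gen S : is_ideal (ideal_gen S).
Proof.
split=> [J|f g If Ig J JI SJ|f g Ig J JI SJ].
  by case.
  by case: (JI) => _ JD _; apply: JD; [exact: If | exact: Ig].
by case: (JI) => _ _ JM; apply: JM; exact: Ig.
Qed.

Lemma ideal_gen_sub S s : S s -> ideal_gen S s.
Proof. by move=> Ss J _; apply. Qed.

Lemma idealB I f g : is_ideal I -> I f -> I g -> I (f - g).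
Proof. by case=> _ ID IM If Ig; rewrite -mulN1r; apply/ID/IM. Qed.

Lemma ideal_cancel I f g : is_ideal I -> I g -> I (f - g) -> I f.
Proof. by case=> _ ID _ Ig Ifg; rewrite -(subrK g f); apply: ID. Qed.

Lemma is_ideal_colon I f : is_ideal I -> is_ideal (colon I f).
Proof.
rewrite /colon; case=> I0 ID IM; split=> [|g h Ig Ih|g h Ih].
- by rewrite mul0r.
- by rewrite mulrDl; apply: ID.
- by rewrite -mulrA; apply: IM.
Qed.

Lemma ideal_mull I f g : is_ideal I -> I f -> I (f * g).
Proof. by case=> _ _ IM If; rewrite mulrC; apply: IM. Qed.

Lemma prime_sqr P f : is_prime_ideal P -> P (f * f) -> P f.
Proof. by case=> _ _ PP /PP[]. Qed.

End IdealTheory.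

(** The preimage of the principal ideal generated by [s]: that every evaluated element of an ideal
    is divisible by [s] then needs checking on generators only. *)
Lemma is_ideal_dvd_preim (R S : comNzRingType) (h : {rmorphism R -> S}) (s : S) :
  is_ideal (fun f => exists q, h f = q * s).
Proof.
split=> [|f g [q fE] [r gE]|f g [r gE]].
- by exists 0; rewrite rmorph0 mul0r.
- by exists (q + r); rewrite rmorphD fE gE mulrDl.
- by exists (h f * r); rewrite rmorphM gE mulrA.
Qed.

(** Extracts the coefficients below degree 4 from a divisibility by ['X^4]. In the applications all
    higher terms are moved into [q]. *)
Lemma polyX4_inj (R : comNzRingType) (c0 c1 c2 c3 : R) (q : {poly R}) :
    c0%:P + c1%:P * 'X + c2%:P * 'X^2 + c3%:P * 'X^3 = q * 'X^4 ->
  [/\ c0 = 0, c1 = 0, c2 = 0 & c3 = 0].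
Proof.
move=> /polyP E; split; [move: (E 0) | move: (E 1) | move: (E 2) | move: (E 3)];
  rewrite !coefE /= ?mulr0 ?mulr1 ?addr0 ?add0r //.
Qed.

(** * Homogeneous polynomials of low degree, evaluations and coefficients *)

Section Homogeneous.
Variable (K : fieldType) (n : nat).

(** Indexing by [nat] allows numerals for concrete variables. An index out of range falls back to
    variable 0, hence the bounds on [i] in the evaluation lemmas. *)
Definition hvar (i : nat) : {mpoly K[n.+1]} := 'X_(inord i).

Lemma homog0E (f : {mpoly K[n.+1]}) : f \is 0.-homog -> f = (f@_0)%:MP.
Proof.
move=> /dhomogP Hf; apply/mpolyP => m; rewrite mcoeffC.
have [<-|nm0] := eqVneq; first by rewrite mulr1.
rewrite mulr0; apply: memN_msupp_eq0; apply/negP => /Hf /eqP.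
by rewrite /= mdeg_eq0 (negPf nm0).
Qed.

(** A monomial of positive degree is divisible by some variable, which is factored out; summing over
    the support gives the decomposition. It is not unique. *)
Lemma homogSE d (f : {mpoly K[n.+1]}) : f \is d.+1.-homog ->
  exists2 g : nat -> {mpoly K[n.+1]}, (forall i, g i \is d.-homog)
    & f = \sum_(0 <= i < n.+1) hvar i * g i.
Proof.
move=> /dhomogP Hf; rewrite [f]mpolyE big_seq.
apply: (big_ind (fun p => exists2 g : nat -> {mpoly K[n.+1]},
  (forall i, g i \is d.-homog) & p = \sum_(0 <= i < n.+1) hvar i * g i)).
- exists (fun=> 0); first by move=> i; apply: dhomog0.
  by rewrite big1 // => i _; rewrite mulr0.
- move=> p q [g Hg ->] [h Hh ->]; exists (fun i => g i + h i).
    by move=> i; apply: dhomogD.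
  by rewrite -big_split; apply: eq_bigr => i _; rewrite mulrDr.
move=> m /Hf /= mdm.
have [i mi] : exists i, m i != 0%N.
  apply/existsP; rewrite -negb_forall; apply/negP => /forallP m0.
  have m_eq0 : m = 0%MM.
    by apply/mnmP => i; rewrite mnm0E; apply/eqP; rewrite -[_ == _]negbK m0.
  by move: mdm; rewrite m_eq0 mdeg0.
have lim : (U_(i) <= m)%MM.
  by apply/mnm_lepP => j; rewrite mnm1E; case: eqP => [<-|//]; rewrite lt0n.
(* The whole monomial is charged to the chosen variable [i]; all other cofactors are 0. *)
exists (fun j => if j == i :> nat then f@_m *: 'X_[m - U_(i)] else 0).
  move=> j; case: eqP => _; last exact: dhomog0.
  apply: dhomogZ; rewrite dhomogX /=.
  have := mdegD (m - U_(i))%MM U_(i)%MM; rewrite submK // mdm mdeg1 addn1.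
  by case=> ->.
rewrite big_mkord (bigD1 i) //= eqxx big1 => [|j nij]; last first.
  by rewrite val_eqE (negPf nij) mulr0.
by rewrite addr0 /hvar inord_val -scalerAr -mpolyXD addmC submK.
Qed.

Lemma homog1E (f : {mpoly K[n.+1]}) : f \is 1.-homog ->
  exists c : nat -> K, f = \sum_(0 <= i < n.+1) hvar i * (c i)%:MP.
Proof.
move=> /homogSE[g Hg ->]; exists (fun i => (g i)@_0).
by apply: eq_bigr => i _; rewrite {1}(homog0E (Hg i)).
Qed.

Lemma hvar_homog i : hvar i \is 1.-homog.
Proof. by rewrite /hvar dhomogX /= mdeg1. Qed.

Lemma hvar_neq0 i : hvar i != 0.
Proof. by rewrite /hvar -msupp_eq0 msuppX. Qed.

Section Eval.
Variable (L : comNzRingType) (h : {rmorphism K -> L}) (w : seq L).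

(** Entries missing from [w] read as 0, so [[::]] is evaluation at the origin. *)
Definition heval : {rmorphism {mpoly K[n.+1]} -> L} :=
  mmap h (fun i => w`_i).

Lemma hevalC c : heval c%:MP = h c.
Proof. exact: mmapC. Qed.

Lemma heval_hvar i : (i < n.+1)%N -> heval (hvar i) = w`_i.
Proof. by move=> lin; rewrite /heval /= /hvar mmapX mmap1U inordK. Qed.

End Eval.

(* [hcoef f l] is the coefficient in [f] of the monomial with exponents [l]. *)
Definition hcoef (f : {mpoly K[n.+1]}) (l : seq nat) : K :=
  f@_[multinom nth 0%N l i | i < n.+1].

(** Peels off the last variable of a product, so that coefficients of explicit monomial multiples
    are computed by rewriting. *)
Lemma hcoefMX f i l : (i < n.+1)%N -> hcoef (f * hvar i) l =
  if nth 0%N l i is k.+1 then hcoef f (set_nth 0%N l i k) else 0.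
Proof.
move=> lin; rewrite /hcoef /hvar.
case E: (nth 0%N l i) => [|k].
  apply: memN_msupp_eq0; rewrite (perm_mem (msuppMX _ _)); apply/negP => /mapP[m _].
  move/mnmP/(_ (inord i)); rewrite mnmE mnmDE mnm1E inordK // E eqxx.
  by [].
rewrite -(mcoeffMX f U_(inord i)); congr (_ @_ _); apply/mnmP => j.
rewrite mnmDE !mnmE nth_set_nth /= -val_eqE /= inordK // eq_sym.
by case: eqP => [->|_]; rewrite ?E.
Qed.

Lemma hcoefD f g l : hcoef (f + g) l = hcoef f l + hcoef g l.
Proof. exact: mcoeffD. Qed.

Lemma hcoefC x l : all (pred1 0%N) l -> hcoef x%:MP l = x.
Proof.
move=> l0; rewrite /hcoef mcoeffC (_ : _ == _) ?mulr1 //.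
apply/eqP/mnmP => i; rewrite mnmE mnm0E.
have [lti|gei] := ltnP i (size l); last by rewrite nth_default.
by have /eqP -> := allP l0 _ (mem_nth 0%N lti).
Qed.

Lemma hcoef0 l : hcoef 0 l = 0.
Proof. exact: mcoeff0. Qed.

End Homogeneous.
Arguments heval : simpl never.

(** * Prime kernels and morphisms congruent modulo an ideal *)

Lemma ideal_half (R : comNzRingType) (I : R -> Prop) (h f : R) :
  is_ideal I -> h * 2 = 1 -> I (2 * f) -> I f.
Proof. by case=> _ _ IM h2 If; rewrite -[f]mul1r -h2 -mulrA; apply: IM. Qed.

Lemma is_prime_ker (R : comNzRingType) (S : idomainType) (h : {rmorphism R -> S}) :
  is_prime_ideal (fun f => h f = 0).
Proof.
split.
- split=> [|f g fE gE|f g gE]; first exact: rmorph0.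
    by rewrite rmorphD fE gE addr0.
  by rewrite rmorphM gE mulr0.
- by rewrite rmorph1; apply/eqP/oner_neq0.
- by move=> f g /eqP; rewrite rmorphM mulf_eq0 => /orP[]/eqP; [left|right].
Qed.

(** The elements on which [h1] and [h2] agree modulo [Q] are closed under sums and products, and
    constants and variables generate the polynomial ring. *)
Lemma rmorph_ideal_congr (K : fieldType) (n : nat) (S : comNzRingType)
    (h1 h2 : {rmorphism {mpoly K[n.+1]} -> S}) (Q : S -> Prop) :
    is_ideal Q -> (forall c, h1 c%:MP = h2 c%:MP) ->
    (forall i, (i < n.+1)%N -> Q (h1 (hvar K n i) - h2 (hvar K n i))) ->
  forall f, Q (h1 f - h2 f).
Proof.
move=> QI hC hX; have [Q0 QD QM] := QI.
have HD f g : Q (h1 f - h2 f) -> Q (h1 g - h2 g) ->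
    Q (h1 (f + g) - h2 (f + g)).
  by move=> Hf Hg; rewrite !rmorphD opprD addrACA; apply: QD.
have HM f g : Q (h1 f - h2 f) -> Q (h1 g - h2 g) ->
    Q (h1 (f * g) - h2 (f * g)).
  move=> Hf Hg; rewrite !rmorphM.
  have -> : h1 f * h1 g - h2 f * h2 g =
    h1 f * (h1 g - h2 g) + h2 g * (h1 f - h2 f) by ring.
  by apply: QD; apply: QM.
move=> f; rewrite [f]mpolyE.
apply: (big_ind (fun p => Q (h1 p - h2 p)) _ HD) => [|m _].
  by rewrite !rmorph0 subrr.
rewrite -mul_mpolyC; apply: (HM); first by rewrite hC subrr.
rewrite mpolyXE_id; apply: (big_ind (fun p => Q (h1 p - h2 p)) _ HM) => [|i _].
  by rewrite !rmorph1 subrr.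
elim: (m i) => [|k IHk]; first by rewrite !expr0 !rmorph1 subrr.
by rewrite exprS; apply: HM IHk; rewrite -[i]inord_val; apply: hX.
Qed.

(** * Consequences of the three relations of a 2 x 3 Hankel matrix *)

Section PermanentRelations.
Variables (R : comNzRingType) (I : R -> Prop) (a b c d h : R).
Hypotheses (II : is_ideal I) (h2 : h * 2 = 1).
Hypotheses (Iac : I (a * c + b * b)) (Iad : I (a * d + b * c)).
Hypothesis (Ibd : I (b * d + c * c)).

Lemma ideal_comb3 p q r f :
  f = p * (a * c + b * b) + q * (a * d + b * c) + r * (b * d + c * c) -> I f.
Proof. by case: II => _ ID IM ->; apply/ID/IM/Ibd; apply: ID; apply: IM. Qed.

Lemma perm_cubic1 : I (a * b * d).
Proof. by apply: (ideal_half II h2); apply: (@ideal_comb3 (- c) b a); ring. Qed.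

Lemma perm_cubic2 : I (a * c * d).
Proof. by apply: (ideal_half II h2); apply: (@ideal_comb3 d c (- b)); ring. Qed.

(** Since abd lies in P, so does a, b or d. If a does, then b^2 = -ac and c^2 = -bd modulo P give b
    and then c; the case of d is the mirror image. If b does, then ad = -bc modulo P leads back to a
    or d. *)
Lemma perm_prime P : is_prime_ideal P -> (forall f, I f -> P f) ->
  [/\ P b, P c & P a \/ P d].
Proof.
move=> PP IP; have [PI _ PM] := PP; have [_ _ PMl] := PI.
have Pa : P a -> P b /\ P c.
  move=> Ha; have Hb : P b.
    apply: (prime_sqr PP); rewrite -[_ * _](addKr (a * c)) addrC.
    by apply: idealB => //; [apply: IP | apply: ideal_mull].
  split=> //; apply: (prime_sqr PP); rewrite -[_ * _](addKr (b * d)) addrC.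
  by apply: idealB => //; [apply: IP | apply: ideal_mull].
have Pd : P d -> P b /\ P c.
  move=> Hd; have Hc : P c.
    apply: (prime_sqr PP); rewrite -[_ * _](addKr (b * d)) addrC.
    by apply: idealB => //; [apply: IP | apply: PMl].
  split=> //; apply: (prime_sqr PP); rewrite -[_ * _](addKr (a * c)) addrC.
  by apply: idealB => //; [apply: IP | apply: PMl].
have [/PM[|Hb]|] := PM _ _ (IP _ perm_cubic1).
- by move=> Ha; case: (Pa Ha) => *; split=> //; left.
- have : P (a * d).
    rewrite -[_ * _](addrK (b * c)); apply: idealB => //; first exact: IP.
    exact: ideal_mull.
  case/PM=> H; first by case: (Pa H) => *; split=> //; left.
  by case: (Pd H) => *; split=> //; right.
- by move=> Hd; case: (Pd Hd) => *; split=> //; right.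
Qed.

End PermanentRelations.

Lemma half_mpoly (K : fieldType) n : 2%N \notin [pchar K] ->
  ((2^-1)%:MP * 2 = 1 :> {mpoly K[n]}).
Proof.
rewrite inE /= => K2; rewrite -[2 in X in _ * X](rmorph_nat (@mpolyC n K)).
by rewrite -rmorphM /= mulVf // rmorph1.
Qed.

(** * The 2 x 3 matrix *)

Section Hankel23.
Variable K : fieldType.
Hypothesis charK : 2%N \notin [pchar K].

Local Notation I := (perm2_ideal (hankel K 2 3)).
Local Notation a := (hvar K 3 0).
Local Notation b := (hvar K 3 1).
Local Notation c := (hvar K 3 2).
Local Notation d := (hvar K 3 3).

Lemma hankel23E (i : 'I_2) (j : 'I_3) : hankel K 2 3 i j = hvar K 3 (i + j).
Proof.
rewrite mxE /hvar; congr ('X_ _); apply: val_inj.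
by rewrite /= inordK // hankel_idx_subproof.
Qed.

Lemma is_ideal23 : is_ideal I.
Proof. exact: is_ideal_gen. Qed.

Lemma hankel23_min J : is_ideal J ->
    J (a * c + b * b) -> J (a * d + b * c) -> J (b * d + c * c) ->
  forall f, I f -> J f.
Proof.
move=> JI Jac Jad Jbd f; apply=> // _ [i [j [k [l [ij kl ->]]]]].
rewrite !hankel23E; move: i j k l ij kl.
case=> [[|[|?]] //= ?] [[|[|?]] //= ?].
by case=> [[|[|[|?]]] //= ?] [[|[|[|?]]] //= ?] _ _; rewrite ?[c * b]mulrC.
Qed.

Lemma hankel23_gens : [/\ I (a * c + b * b), I (a * d + b * c) & I (b * d + c * c)].
Proof.
pose r0 := @Ordinal 2 0 isT; pose r1 := @Ordinal 2 1 isT.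
pose c0 := @Ordinal 3 0 isT; pose c1 := @Ordinal 3 1 isT.
pose c2 := @Ordinal 3 2 isT.
split; apply: ideal_gen_sub.
- by exists r0, r1, c0, c1; rewrite !hankel23E.
- by exists r0, r1, c0, c2; rewrite !hankel23E [b * c]mulrC.
- by exists r0, r1, c1, c2; rewrite !hankel23E.
Qed.

(** The extra scale [t] is 1 in the degree bounds and the variable d when the colon ideal of the
    witness a d^2 is computed. *)
Lemma eval23_right (L : comNzRingType) (h : {rmorphism K -> L}) (s t : L) f :
  I f -> exists q,
    heval 3 h [:: s ^+ 3 * t; - s ^+ 2 * t; s * t; t] f = q * s ^+ 4.
Proof.
move: f; apply: (hankel23_min (is_ideal_dvd_preim _ (s ^+ 4))).
all: rewrite rmorphD !rmorphM !heval_hvar //=.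
- by exists (2 * t * t); ring.
- by exists 0; ring.
- by exists 0; ring.
Qed.

Lemma eval23_left (L : comNzRingType) (h : {rmorphism K -> L}) (s : L) f :
  I f -> exists q, heval 3 h [:: 1; s; - s ^+ 2; s ^+ 3] f = q * s ^+ 4.
Proof.
move: f; apply: (hankel23_min (is_ideal_dvd_preim _ (s ^+ 4))).
all: rewrite rmorphD !rmorphM !heval_hvar //=.
- by exists 0; ring.
- by exists 0; ring.
- by exists 2; ring.
Qed.

(** The generators replace b^2, bc and c^2 by -ac, -ad and -bd; the seven other quadratic monomials
    remain. *)
Lemma quadric23_normal f : f \is 2.-homog ->
  exists c0 c1 c2 c3 c4 c5 c6 : K,
    I (f - (c0%:MP * a * a + c1%:MP * a * b + c2%:MP * a * c + c3%:MP * a * d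
            + c4%:MP * b * d + c5%:MP * c * d + c6%:MP * d * d)).
Proof.
case/homogSE=> g Hg ->; rewrite unlock /=.
have [u uE] := homog1E (Hg 0%N); have [v vE] := homog1E (Hg 1%N).
have [w wE] := homog1E (Hg 2%N); have [z zE] := homog1E (Hg 3%N).
rewrite uE vE wE zE unlock /=.
exists (u 0), (u 1 + v 0), (u 2 + w 0 - v 1), (u 3 + z 0 - v 2 - w 1).
exists (v 3 + z 1 - w 2), (w 3 + z 2), (z 3).
case: hankel23_gens => Iac Iad Ibd.
apply: (ideal_comb3 is_ideal23 Iac Iad Ibd (p := (v 1%N)%:MP)
  (q := (v 2%N + w 1%N)%:MP) (r := (w 2%N)%:MP)).
by rewrite !(rmorphB, rmorphD) /=; ring.
Qed.

(** By [perm_prime], this is what an equality of (I : f) with a prime forces on f. Unlike that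
    equality, it passes to multiples of f. *)
Definition killed23 f := [/\ I (b * f), I (c * f) & I (a * f) \/ I (d * f)].

Lemma killed23_deg2 f : f \is 2.-homog -> killed23 f -> I f.
Proof.
case/quadric23_normal=> [u0 [u1 [u2 [u3 [u4 [u5 [u6]]]]]]].
set g := (X in f - X) => If [Ib Ic Iad].
apply: (ideal_cancel is_ideal23 _ If); have [I0 _ IM] := is_ideal23.
have Ig x : I (x * f) -> I (x * g).
  move=> Ixf; rewrite -[x * g](subKr (x * f)) -mulrBr.
  by apply: (idealB is_ideal23) => //; apply: IM.
have [q] := eval23_left (polyC \o idfun) 'X (Ig b Ib).
rewrite !(rmorphD, rmorphM) !hevalC !heval_hvar //= => qE.
(* Since b evaluates to X, the coefficients of [g] appear shifted by one degree, with a zero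
   constant term: only three of them lie below X^4. *)
have [_ u00 u10 /eqP] : [/\ (0 : K) = 0, u0 = 0, u1 = 0 & - u2 = 0].
  apply: (@polyX4_inj _ _ _ _ _ (q - (u3%:P + u4%:P * 'X - u5%:P * 'X^2
    + u6%:P * 'X^3))).
  by rewrite mulrBl -qE rmorph0 rmorphN /=; ring.
rewrite oppr_eq0 => /eqP u20.
have [r] := eval23_right (polyC \o idfun) 'X 1 (Ig c Ic).
rewrite !(rmorphD, rmorphM) !hevalC !heval_hvar //= => rE.
have [_ u60 u50 /eqP] : [/\ (0 : K) = 0, u6 = 0, u5 = 0 & - u4 = 0].
  apply: (@polyX4_inj _ _ _ _ _ (r - (u3%:P + u2%:P * 'X - u1%:P * 'X^2
    + u0%:P * 'X^3))).
  by rewrite mulrBl -rE rmorph0 rmorphN /=; ring.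
rewrite oppr_eq0 => /eqP u40.
suff u30 : u3 = 0.
  by rewrite /g u00 u10 u20 u30 u40 u50 u60 !rmorph0 !mul0r !addr0.
(* Here a on the left curve, or d on the right one, evaluates to 1. Nothing is shifted, and the X^3
   coefficient is [u3]. *)
case: Iad => [Ia|Id].
  have [p] := eval23_left (polyC \o idfun) 'X (Ig a Ia).
  rewrite !(rmorphD, rmorphM) !hevalC !heval_hvar //= => pE.
  suff [] : [/\ u0 = 0, u1 = 0, - u2 = 0 & u3 = 0] by [].
  apply: (@polyX4_inj _ _ _ _ _ (p - (u4%:P - u5%:P * 'X + u6%:P * 'X^2))).
  by rewrite mulrBl -pE rmorphN /=; ring.
have [p] := eval23_right (polyC \o idfun) 'X 1 (Ig d Id).
rewrite !(rmorphD, rmorphM) !hevalC !heval_hvar //= => pE.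
suff [] : [/\ u6 = 0, u5 = 0, - u4 = 0 & u3 = 0] by [].
apply: (@polyX4_inj _ _ _ _ _ (p - (u2%:P - u1%:P * 'X + u0%:P * 'X^2))).
by rewrite mulrBl -pE rmorphN /=; ring.
Qed.

Lemma killed23_deg1 f : f \is 1.-homog -> killed23 f -> f = 0.
Proof.
case/homog1E=> u -> [Ib Ic _]; move: Ib Ic; rewrite unlock /= => Ib Ic.
have [q] := eval23_left (polyC \o idfun) 'X Ib.
rewrite !(rmorphD, rmorphM, rmorph0) !hevalC !heval_hvar //= => qE.
have [_ u00 u10 /eqP] : [/\ (0 : K) = 0, u 0 = 0, u 1 = 0 & - u 2 = 0].
  apply: (@polyX4_inj _ _ _ _ _ (q - (u 3%N)%:P)).
  by rewrite mulrBl -qE rmorph0 rmorphN /=; ring.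
rewrite oppr_eq0 => /eqP u20.
have [r] := eval23_right (polyC \o idfun) 'X 1 Ic.
rewrite !(rmorphD, rmorphM, rmorph0) !hevalC !heval_hvar //= => rE.
have [_ u30 _ _] : [/\ (0 : K) = 0, u 3 = 0, u 2 = 0 & - u 1 = 0].
  apply: (@polyX4_inj _ _ _ _ _ (r - (u 0%N)%:P)).
  by rewrite mulrBl -rE rmorph0 rmorphN /=; ring.
by rewrite u00 u10 u20 u30 !rmorph0 !mulr0 !addr0.
Qed.

Lemma killed23M f g : killed23 f -> killed23 (g * f).
Proof.
have [_ _ IM] := is_ideal23; case=> Ib Ic Iad.
split; [rewrite mulrCA; exact: IM | rewrite mulrCA; exact: IM |].
by case: Iad => H; [left|right]; rewrite mulrCA; apply: IM.
Qed.

Lemma killed23_low e f : (e < 3)%N -> f \is e.-homog -> killed23 f -> I f.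
Proof.
have [I0 _ _] := is_ideal23; case: e => [|[|[|//]]] _ Hf kf.
(* A constant is multiplied by a to reach the degree 1 case. *)
- have /eqP : a * f = 0.
    by apply: killed23_deg1; [apply: (dhomogM (hvar_homog _ _ _) Hf)
      | apply: killed23M].
  by rewrite mulf_eq0 (negPf (hvar_neq0 _ _ _)) /= => /eqP ->.
- by rewrite (killed23_deg1 Hf).
- exact: killed23_deg2.
Qed.

Lemma v_degree23_ge e : v_degree I e -> (3 <= e)%N.
Proof.
case=> f [P [Hf [PP _] fP]]; rewrite leqNgt; apply/negP => e3.
(* The contradiction sought is that 1 lies in P = (I : f), that is, f lies in I. *)
have [_ P1 _] := PP; case: P1.
have [Iac Iad Ibd] := hankel23_gens.
have IP g : I g -> P g by move=> Ig; apply/fP; apply: ideal_mull Ig; apply: is_ideal23.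
have [Pb Pc Pad] := perm_prime is_ideal23 (half_mpoly _ charK) Iac Iad Ibd PP IP.
apply/fP; rewrite /colon mul1r; apply: (killed23_low e3 Hf).
split; try exact/fP.
by case: Pad => H; [left|right]; apply/fP.
Qed.

Lemma v_degree23 : v_degree I 3.
Proof.
have [Iac Iad Ibd] := hankel23_gens; have [_ ID IM] := is_ideal23.
have Iabd := perm_cubic1 is_ideal23 (half_mpoly _ charK) Iac Iad Ibd.
have Iacd := perm_cubic2 is_ideal23 (half_mpoly _ charK) Iac Iad Ibd.
(* Setting a = b = c = 0 and keeping d: the kernel is the prime (a, b, c). *)
pose th := heval 3 (@mpolyC 4 K) [:: 0; 0; 0; d].
pose f := a * d * d.
(* Modulo (I : f) each polynomial equals its image under [th], because a, b and c kill f modulo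
   I. *)
have If g : I ((g - th g) * f).
  apply: (rmorph_ideal_congr (h1 := idfun) (h2 := th)
    (is_ideal_colon f is_ideal23)) => [x|i] /=.
    by rewrite /th hevalC.
  rewrite /th /colon /f => lti; rewrite heval_hvar //.
  case: i lti => [|[|[|[|//]]]] _ /=; rewrite ?subr0.
  - have -> : a * (a * d * d) = (a * d) * (a * d + b * c) - c * (a * b * d)
      by ring.
    by apply: (idealB is_ideal23); apply: IM.
  - have -> : b * (a * d * d) = d * (a * b * d) by ring.
    exact: IM.
  - have -> : c * (a * d * d) = d * (a * c * d) by ring.
    exact: IM.
  - by rewrite subrr mul0r; case: is_ideal23.
have PE : ideal_eq (colon I f) (fun g => th g = 0).
  move=> g; split=> [Igf|g0]; last first.
    by have := If g; rewrite g0 subr0.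
  have : I (th g * f).
    have -> : th g * f = g * f - (g - th g) * f by ring.
    exact: (idealB is_ideal23).
  set u := th g => Iu.
  (* On this curve over K[a, b, c, d][X], the point is (0, 0, 0, d) modulo X, so g becomes u + vX
     while f becomes d^3 X^3. Divisibility by X^4 leaves u d^3 = 0, hence u = 0. *)
  have [q] := eval23_right (polyC \o @mpolyC 4 K) 'X d%:P Igf.
  have [v] : exists v, heval 3 (polyC \o @mpolyC 4 K)
      [:: 'X ^+ 3 * d%:P; - 'X ^+ 2 * d%:P; 'X * d%:P; d%:P] g - u%:P = v * 'X.
    apply: (rmorph_ideal_congr (h2 := polyC \o th)
      (is_ideal_dvd_preim idfun 'X)) => [x|i lti] /=.
      by rewrite /th !hevalC.
    rewrite /th !heval_hvar //; case: i lti => [|[|[|[|//]]]] _ /=.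
    + by exists ('X ^+ 2 * d%:P); rewrite rmorph0; ring.
    + by exists (- 'X * d%:P); rewrite rmorph0; ring.
    + by exists d%:P; rewrite rmorph0; ring.
    + by exists 0; ring.
  move/eqP; rewrite subr_eq => /eqP gE; rewrite !rmorphM gE !heval_hvar //= => qE.
  have [_ _ _ /eqP] : [/\ (0 : {mpoly K[4]}) = 0, (0 : {mpoly K[4]}) = 0,
      (0 : {mpoly K[4]}) = 0 & u * (d * d * d) = 0].
    apply: (@polyX4_inj _ _ _ _ _ (q - v * d%:P ^+ 3)).
    by rewrite mulrBl -qE rmorph0 !rmorphM /=; ring.
  by rewrite !mulf_eq0 !(negPf (hvar_neq0 _ _ _)) !orbF => /eqP.
exists f, (fun g => th g = 0); split=> //.
  have Hv := @hvar_homog K 3.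
  by apply: (dhomogM (d := 2) (e := 1)) => //; apply: (dhomogM (d := 1) (e := 1)).
split; first exact: is_prime_ker.
by exists f => g; split=> /PE.
Qed.

End Hankel23.

(** * The 3 x 3 matrix *)

Section Hankel33.
Variable K : fieldType.
Hypothesis charK : 2%N \notin [pchar K].

Local Notation I := (perm2_ideal (hankel K 3 3)).
Local Notation a := (hvar K 4 0).
Local Notation b := (hvar K 4 1).
Local Notation c := (hvar K 4 2).
Local Notation d := (hvar K 4 3).
Local Notation e := (hvar K 4 4).

Lemma hankel33E (i j : 'I_3) : hankel K 3 3 i j = hvar K 4 (i + j).
Proof.
rewrite mxE /hvar; congr ('X_ _); apply: val_inj.
by rewrite /= inordK // hankel_idx_subproof.
Qed.

Lemma is_ideal33 : is_ideal I.
Proof. exact: is_ideal_gen. Qed.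

Lemma hankel33_min J : is_ideal J ->
    J (a * c + b * b) -> J (a * d + b * c) -> J (b * d + c * c) ->
    J (a * e + c * c) -> J (b * e + c * d) -> J (c * e + d * d) ->
  forall f, I f -> J f.
Proof.
move=> JI Jac Jad Jbd Jae Jbe Jce f; apply=> // _ [i [j [k [l [ij kl ->]]]]].
rewrite !hankel33E; move: i j ij k l kl.
case=> [[|[|[|?]]] //= ?] [[|[|[|?]]] //= ?] // _;
case=> [[|[|[|?]]] //= ?] [[|[|[|?]]] //= ?] // _;
by rewrite ?[c * b]mulrC ?[d * c]mulrC.
Qed.

Lemma hankel33_gens :
  [/\ I (a * c + b * b), I (a * d + b * c) & I (b * d + c * c)] /\
  [/\ I (a * e + c * c), I (b * e + c * d) & I (c * e + d * d)].
Proof.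
pose o0 := @Ordinal 3 0 isT; pose o1 := @Ordinal 3 1 isT.
pose o2 := @Ordinal 3 2 isT.
split; split; apply: ideal_gen_sub.
- by exists o0, o1, o0, o1; rewrite !hankel33E.
- by exists o0, o1, o0, o2; rewrite !hankel33E [b * c]mulrC.
- by exists o0, o1, o1, o2; rewrite !hankel33E.
- by exists o0, o2, o0, o2; rewrite !hankel33E.
- by exists o0, o2, o1, o2; rewrite !hankel33E [c * d]mulrC.
- by exists o1, o2, o1, o2; rewrite !hankel33E.
Qed.

(** The right-hand curve of the 2 x 3 case, now on b, c, d, e. The value of a may be any multiple of
    s^4, and 0 is the simplest. *)
Lemma eval33_right (L : comNzRingType) (h : {rmorphism K -> L}) (s : L) f :
  I f -> exists q, heval 4 h [:: 0; s ^+ 3; - s ^+ 2; s; 1] f = q * s ^+ 4.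
Proof.
move: f; apply: (hankel33_min (is_ideal_dvd_preim _ (s ^+ 4))).
all: rewrite rmorphD !rmorphM !heval_hvar //=.
- by exists (s ^+ 2); ring.
- by exists (- s); ring.
- by exists 2; ring.
- by exists 1; ring.
- by exists 0; ring.
- by exists 0; ring.
Qed.

Lemma eval33_left (L : comNzRingType) (h : {rmorphism K -> L}) (s : L) f :
  I f -> exists q, heval 4 h [:: 1; s; - s ^+ 2; s ^+ 3; 0] f = q * s ^+ 4.
Proof.
move: f; apply: (hankel33_min (is_ideal_dvd_preim _ (s ^+ 4))).
all: rewrite rmorphD !rmorphM !heval_hvar //=.
- by exists 0; ring.
- by exists 0; ring.
- by exists 2; ring.
- by exists 1; ring.
- by exists (- s); ring.
- by exists (s ^+ 2); ring.
Qed.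

(* Modulo the ideal, every cubic monomial whose indices sum to 6 is [c ^+ 3]
   up to a sign, which is its coefficient here. *)
Definition socle_form (f : {mpoly K[5]}) : K :=
  hcoef f [:: 0; 0; 3; 0; 0]%N - hcoef f [:: 0; 1; 1; 1; 0]%N
  - hcoef f [:: 1; 0; 1; 0; 1]%N + hcoef f [:: 1; 0; 0; 2; 0]%N
  + hcoef f [:: 0; 2; 0; 0; 1]%N.

Lemma socle_formD f g : socle_form (f + g) = socle_form f + socle_form g.
Proof.
rewrite /socle_form !hcoefD; do 10!(move: (hcoef _ _) => ?).
by ring.
Qed.

(** The elements all of whose multiples are killed by the form make up an ideal, so it suffices to
    test g times each generator. There only linear coefficients of g enter, and they cancel. *)
Lemma socle_form_ideal f : I f -> socle_form f = 0.
Proof.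
have JI : is_ideal (fun f => forall g, socle_form (g * f) = 0).
  split=> [g|f1 f2 H1 H2 g|f1 f2 H2 g].
  - by rewrite mulr0 /socle_form !hcoef0; ring.
  - by rewrite mulrDr socle_formD H1 H2 addr0.
  - by rewrite mulrA.
move=> If; rewrite -[f]mul1r; move: f If 1; apply: (hankel33_min JI) => g;
  rewrite mulrDr !mulrA /socle_form !hcoefD.
all: by do 3!rewrite ?hcoefMX //=; ring.
Qed.

(** The generators replace b^2, bc, bd, ae, cd and d^2 by -ac, -ad, -c^2, -c^2, -be and -ce. The
    nine remaining monomials have distinct index sums, 0 to 8. *)
Lemma quadric33_normal f : f \is 2.-homog ->
  exists c0 c1 c2 c3 c4 c5 c6 c7 c8 : K,
    I (f - (c0%:MP * a * a + c1%:MP * a * b + c2%:MP * a * c + c3%:MP * a * d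
            + c4%:MP * c * c + c5%:MP * b * e + c6%:MP * c * e
            + c7%:MP * d * e + c8%:MP * e * e)).
Proof.
case/homogSE=> g Hg ->; rewrite unlock /=.
have [u uE] := homog1E (Hg 0%N); have [v vE] := homog1E (Hg 1%N).
have [w wE] := homog1E (Hg 2%N); have [z zE] := homog1E (Hg 3%N).
have [y yE] := homog1E (Hg 4%N).
rewrite uE vE wE zE yE unlock /=.
exists (u 0), (u 1 + v 0), (u 2 + w 0 - v 1), (u 3 + z 0 - v 2 - w 1).
exists (w 2 - (u 4 + y 0) - (v 3 + z 1)), (v 4 + y 1 - (w 3 + z 2)).
exists (w 4 + y 2 - z 3), (z 4 + y 3), (y 4).
case: hankel33_gens => [[Iac Iad Ibd] [Iae Ibe Ice]].
have [_ ID IM] := is_ideal33.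
set t := (X in I X).
have -> : t = (v 1%N)%:MP * (a * c + b * b)
  + (v 2%N + w 1%N)%:MP * (a * d + b * c) + (v 3%N + z 1%N)%:MP * (b * d + c * c)
  + (u 4 + y 0%N)%:MP * (a * e + c * c) + (w 3 + z 2)%:MP * (b * e + c * d)
  + (z 3)%:MP * (c * e + d * d).
  by rewrite /t !(rmorphB, rmorphD) /=; ring.
by do 5!(apply: (ID); last exact: IM); exact: IM.
Qed.

(** Every prime over I contains b and c by [perm_prime], and then d because d^2 = -ce modulo I. *)
Definition killed33 f := [/\ I (b * f), I (c * f) & I (d * f)].

Lemma killed33_deg2 f : f \is 2.-homog -> killed33 f -> I f.
Proof.
case/quadric33_normal=> [u0 [u1 [u2 [u3 [u4 [u5 [u6 [u7 [u8]]]]]]]]].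
set g := (X in f - X) => If [Ib Ic Id].
apply: (ideal_cancel is_ideal33 _ If); have [I0 _ IM] := is_ideal33.
have Ig x : I (x * f) -> I (x * g).
  move=> Ixf; rewrite -[x * g](subKr (x * f)) -mulrBr.
  by apply: (idealB is_ideal33) => //; apply: IM.
(* The left curve applied to bg removes index sums 0, 1, 2; the right curve applied to dg removes 8,
   7, 6. *)
have [q] := eval33_left (polyC \o idfun) 'X (Ig b Ib).
rewrite !(rmorphD, rmorphM) !hevalC !heval_hvar //= => qE.
have [_ u00 u10 /eqP] : [/\ (0 : K) = 0, u0 = 0, u1 = 0 & - u2 = 0].
  apply: (@polyX4_inj _ _ _ _ _ (q - (u3%:P + u4%:P * 'X))).
  by rewrite mulrBl -qE rmorph0 rmorphN /=; ring.
rewrite oppr_eq0 => /eqP u20.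
have [r] := eval33_right (polyC \o idfun) 'X (Ig d Id).
rewrite !(rmorphD, rmorphM) !hevalC !heval_hvar //= => rE.
have [_ u80 u70 /eqP] : [/\ (0 : K) = 0, u8 = 0, u7 = 0 & - u6 = 0].
  apply: (@polyX4_inj _ _ _ _ _ (r - (u5%:P + u4%:P * 'X))).
  by rewrite mulrBl -rE rmorph0 rmorphN /=; ring.
rewrite oppr_eq0 => /eqP u60.
have gE : g = u3%:MP * a * d + u4%:MP * c * c + u5%:MP * b * e.
  by rewrite /g u00 u10 u20 u60 u70 u80 !rmorph0; ring.
(* The surviving ad, c^2 and be have index sums 3, 4 and 5. Multiplying by d, c and b respectively
   brings exactly one of them to sum 6, where [socle_form] has coefficient 1 or -1... in fact 1 on a
   d^2, c^3 and b^2 e. *)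
have [u30 u40 u50] : [/\ u3 = 0, u4 = 0 & u5 = 0].
  split; [move: (socle_form_ideal (Ig d Id)) | move: (socle_form_ideal (Ig c Ic))
    | move: (socle_form_ideal (Ig b Ib))]; rewrite mulrC gE !mulrDl !socle_formD;
  rewrite /socle_form; do 3!rewrite ?hcoefMX //=;
  by rewrite hcoefC // !(addr0, subr0, sub0r, add0r, oppr0).
by rewrite gE u30 u40 u50 !rmorph0 !mul0r !addr0.
Qed.

Lemma killed33_deg1 f : f \is 1.-homog -> killed33 f -> f = 0.
Proof.
case/homog1E=> u -> [Ib _ Id]; move: Ib Id; rewrite unlock /= => Ib Id.
have [q] := eval33_left (polyC \o idfun) 'X Ib.
rewrite !(rmorphD, rmorphM, rmorph0) !hevalC !heval_hvar //= => qE.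
have [_ u00 u10 /eqP] : [/\ (0 : K) = 0, u 0 = 0, u 1 = 0 & - u 2 = 0].
  apply: (@polyX4_inj _ _ _ _ _ (q - (u 3%N)%:P)).
  by rewrite mulrBl -qE rmorph0 rmorphN /=; ring.
rewrite oppr_eq0 => /eqP u20.
have [r] := eval33_right (polyC \o idfun) 'X Id.
rewrite !(rmorphD, rmorphM, rmorph0) !hevalC !heval_hvar //= => rE.
have [_ u40 u30 _] : [/\ (0 : K) = 0, u 4 = 0, u 3 = 0 & - u 2 = 0].
  apply: (@polyX4_inj _ _ _ _ _ (r - (u 1%N)%:P)).
  by rewrite mulrBl -rE rmorph0 rmorphN /=; ring.
by rewrite u00 u10 u20 u30 u40 !rmorph0 !mulr0 !addr0.
Qed.

Lemma killed33M f g : killed33 f -> killed33 (g * f).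
Proof.
have [_ _ IM] := is_ideal33; case=> Ib Ic Id.
by split; rewrite mulrCA; apply: IM.
Qed.

Lemma killed33_low k f : (k < 3)%N -> f \is k.-homog -> killed33 f -> I f.
Proof.
have [I0 _ _] := is_ideal33; case: k => [|[|[|//]]] _ Hf kf.
- have /eqP : a * f = 0.
    by apply: killed33_deg1; [apply: (dhomogM (hvar_homog _ _ _) Hf)
      | apply: killed33M].
  by rewrite mulf_eq0 (negPf (hvar_neq0 _ _ _)) /= => /eqP ->.
- by rewrite (killed33_deg1 Hf).
- exact: killed33_deg2.
Qed.

Lemma v_degree33_ge k : v_degree I k -> (3 <= k)%N.
Proof.
case=> f [P [Hf [PP _] fP]]; rewrite leqNgt; apply/negP => k3.
have [PI P1 _] := PP; case: P1.
have [[Iac Iad Ibd] [_ _ Ice]] := hankel33_gens.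
have IP g : I g -> P g.
  by move=> Ig; apply/fP; apply: ideal_mull Ig; apply: is_ideal33.
have [Pb Pc _] := perm_prime is_ideal33 (half_mpoly _ charK) Iac Iad Ibd PP IP.
have Pd : P d.
  apply: (prime_sqr PP); rewrite -[_ * _](addKr (c * e)) addrC.
  by apply: (idealB PI); [apply: IP | apply: (ideal_mull _ PI)].
apply/fP; rewrite /colon mul1r; apply: (killed33_low k3 Hf).
by split; apply/fP.
Qed.

Lemma v_degree33 : v_degree I 3.
Proof.
have [[Iac Iad Ibd] [Iae Ibe Ice]] := hankel33_gens.
have [_ ID IM] := is_ideal33; have h2 := half_mpoly 5 charK.
have Iabd := perm_cubic1 is_ideal33 h2 Iac Iad Ibd.
have Iacd := perm_cubic2 is_ideal33 h2 Iac Iad Ibd.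
(* The variables b, c, d, e satisfy the same three relations as a, b, c, d. *)
have Ibce := perm_cubic1 is_ideal33 h2 Ibd Ibe Ice.
have Ibde := perm_cubic2 is_ideal33 h2 Ibd Ibe Ice.
pose ev := heval 4 (idfun : {rmorphism K -> K}) [::].
pose f := c * c * c.
(* Modulo (I : c^3) each polynomial equals its constant term, because all five variables kill c^3
   modulo I. *)
have If g : I ((g - (ev g)%:MP) * f).
  apply: (rmorph_ideal_congr (h1 := idfun) (h2 := @mpolyC 5 K \o ev)
    (is_ideal_colon f is_ideal33)) => [x|i] /=.
    by rewrite /ev hevalC.
  rewrite /ev /colon /f => lti; rewrite heval_hvar // nth_nil rmorph0 subr0.
  case: i lti => [|[|[|[|[|//]]]]] _.
  - have -> : a * (c * c * c) = (a * c) * (b * d + c * c) - c * (a * b * d)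
      by ring.
    by apply: (idealB is_ideal33); apply: IM.
  - have -> : b * (c * c * c) = (b * c) * (b * d + c * c)
      + d * (a * b * d) - (b * d) * (a * d + b * c) by ring.
    by apply: (idealB is_ideal33); [apply: ID|]; apply: IM.
  - have -> : c * (c * c * c) = (c * c) * (b * d + c * c)
      + (a * e) * (b * d) - (b * d) * (a * e + c * c) by ring.
    apply: (idealB is_ideal33); last exact: IM.
    apply: ID; first exact: IM.
    have -> : a * e * (b * d) = e * (a * b * d) by ring.
    exact: IM.
  - have -> : d * (c * c * c) = (d * c) * (b * d + c * c)
      + b * (b * d * e) - (b * d) * (b * e + c * d) by ring.
    by apply: (idealB is_ideal33); [apply: ID|]; apply: IM.
  - have -> : e * (c * c * c) = (e * c) * (b * d + c * c) - d * (b * c * e)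
      by ring.
    by apply: (idealB is_ideal33); apply: IM.
have PE : ideal_eq (colon I f) (fun g => ev g = 0).
  move=> g; split=> [Igf|g0]; last first.
    by have := If g; rewrite g0 rmorph0 subr0.
  have Ievf : I ((ev g)%:MP * f).
    have -> : (ev g)%:MP * f = g * f - (g - (ev g)%:MP) * f by ring.
    exact: (idealB is_ideal33).
  (* On x c^3 with x constant the form takes the value x, so the constant term of g vanishes. *)
  have := socle_form_ideal Ievf.
  rewrite /f !mulrA /socle_form; do 3!rewrite ?hcoefMX //=.
  by rewrite hcoefC // !(addr0, subr0).
exists f, (fun g => ev g = 0); split=> //.
  have Hv := @hvar_homog K 4.
  by apply: (dhomogM (d := 2) (e := 1)) => //; apply: (dhomogM (d := 1) (e := 1)).
split; first exact: is_prime_ker.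
by exists f => g; split=> /PE.
Qed.

End Hankel33.

Theorem theorem5p4 (K : fieldType) (m n : nat)
    (charK : 2%N \notin [pchar K])
    (hmn : (m, n) = (2%N, 3%N) \/ (m, n) = (3%N, 3%N)) :
  is_v_number (perm2_ideal (hankel K m n)) 3.
Proof.
case: hmn => -[-> ->]; split.
- exact: v_degree23.
- exact: v_degree23_ge.
- exact: v_degree33.
- exact: v_degree33_ge.
Qed.
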